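(* Let $a\in\mathcal{A}$ and let $m\geq 1$ be an integer. The following are equivalent: (1) $a$ has an $m$-generalized right group inverse. (2) $a$ has an $m$-generalized group decomposition, i.e. there exist $x,y\in\mathcal{A}$ such that $a=x+y$, $x^*a^{m-1}y=yx=0$, $x$ has a right group inverse, and $y\in\mathcal{A}^{qnil}$. In this case, for $x$ as in (2), a right group inverse of $x$ is an $m$-generalized right group inverse of $a$.
   Context: $\mathcal{A}$ is a unital complex Banach *-algebra, i.e. a Banach algebra with an involution $*$ satisfying $(x+y)^*=x^*+y^*$, $(\lambda x)^*=\overline{\lambda}x^*$, $(xy)^*=y^*x^*$, $(x^* )^*=x$; the involution is assumed proper: $x^*x=0$ implies $x=0$. $\mathcal{A}^{qnil}=\{x\in\mathcal{A}: \lim_{n\to\infty}\|x^n\|^{1/n}=0\}$. An element $z\in\mathcal{A}$ is a right group inverse of $x\in\mathcal{A}$ if $xz^2=z$ and $x^2z=xzx=x$ (it need not be unique). An element $d\in\mathcal{A}$ is a generalized right Drazin inverse of $a$ if $ad^2=d$, $a^2d=ada$ and $a-ada\in\mathcal{A}^{qnil}$ (it need not be unique). An element $x\in\mathcal{A}$ is an $m$-generalized right group inverse of $a$ if there is a generalized right Drazin inverse $d$ of $a$ such that $x=ax^2$, $(ad)^*a^{m+1}x=(ad)^*a^m$ and $\lim_{n\to\infty}\|a^n-axa^n\|^{1/n}=0$. It need not be unique. *)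

(* Defs.v *)
From HB Require Import structures.
From mathcomp Require Import all_boot all_order all_algebra.
From mathcomp Require Import complex.
From mathcomp Require Import all_classical all_reals all_analysis.

Set Implicit Arguments.
Unset Strict Implicit.
Unset Printing Implicit Defensive.

Import Order.TTheory GRing.Theory Num.Theory.
Import numFieldNormedType.Exports.

Local Open Scope classical_set_scope.
Local Open Scope ring_scope.
Local Open Scope complex_scope.

(* The product and the unit are record fields over a complete normed module
   because Hierarchy Builder rejects a structure joining rings and normed modules
   (it would be a missing join below [numDomainType]).  The ring structure is
   recovered just after, on the carrier.  [`|1| = 1] and [1 != 0] are not
   assumed. *)
Record banachAlgType (R : realType) := BanachAlgebra {
  banach_space : completeNormedModType R[i];
  bone : banach_space;
  bmul : banach_space -> banach_space -> banach_space;
  bmulA : associative bmul;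
  bmul1r : left_id bone bmul;
  bmulr1 : right_id bone bmul;
  bmulDl : left_distributive bmul +%R;
  bmulDr : right_distributive bmul +%R;
  bscaleAl : forall (l : R[i]) x y, l *: bmul x y = bmul (l *: x) y;
  bscaleAr : forall (l : R[i]) x y, l *: bmul x y = bmul x (l *: y);
  bnormM : forall x y, `|bmul x y| <= `|x| * `|y|
}.

Definition banach_sort (R : realType) (A : banachAlgType R) : Type :=
  banach_space A.
Coercion banach_sort : banachAlgType >-> Sortclass.

HB.instance Definition _ (R : realType) (A : banachAlgType R) :=
  CompleteNormedModule.copy (banach_sort A) (banach_space A).
HB.instance Definition _ (R : realType) (A : banachAlgType R) :=
  GRing.Zmodule_isPzRing.Build (banach_sort A)
    (@bmulA R A) (@bmul1r R A) (@bmulr1 R A) (@bmulDl R A) (@bmulDr R A).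

(* The involution is not assumed to be continuous. *)
Record banachStarAlgType (R : realType) := BanachStarAlgebra {
  star_banach_alg :> banachAlgType R;
  star : star_banach_alg -> star_banach_alg;
  starD : forall x y, star (x + y) = star x + star y;
  starZ : forall (l : R[i]) x, star (l *: x) = Num.conj l *: star x;
  starM : forall x y, star (x * y) = star y * star x;
  starK : involutive star
}.

Definition proper_involution (R : realType) (A : banachStarAlgType R) : Prop :=
  forall x : A, star x * x = 0 -> x = 0.

(* The norm of a normed module over [R[i]] takes its (real, nonnegative) values
   in [R[i]]; [Rnorm] is the same norm, valued in [R]. *)
Definition Rnorm (R : realType) (A : banachAlgType R) (x : A) : R :=
  complex.Re `|x|.

(* lim_n ||u_n||^(1/n) = 0; the term of index 0 is irrelevant. *)
Definition root_norm_cvg0 (R : realType) (A : banachAlgType R) (u : nat -> A)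
    : Prop :=
  (fun n : nat => Rnorm (u n) `^ (n%:R)^-1) @ \oo --> (0 : R).

Definition quasinilpotent (R : realType) (A : banachAlgType R) (x : A) : Prop :=
  root_norm_cvg0 (fun n => x ^+ n).

Definition right_group_inverse (R : realType) (A : banachAlgType R)
    (x z : A) : Prop :=
  [/\ x * z ^+ 2 = z, x ^+ 2 * z = x * z * x & x * z * x = x].

Definition gen_right_Drazin_inverse (R : realType) (A : banachAlgType R)
    (a d : A) : Prop :=
  [/\ a * d ^+ 2 = d, a ^+ 2 * d = a * d * a & quasinilpotent (a - a * d * a)].

Definition m_gen_right_group_inverse (R : realType) (A : banachStarAlgType R)
    (m : nat) (a x : A) : Prop :=
  exists d : A,
    [/\ gen_right_Drazin_inverse a d,
        x = a * x ^+ 2,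
        star (a * d) * a ^+ m.+1 * x = star (a * d) * a ^+ m
      & root_norm_cvg0 (fun n => a ^+ n - a * x * a ^+ n)].

(* Meant for [0 < m], where [m.-1] is the genuine predecessor. *)
Definition m_gen_group_decomposition (R : realType) (A : banachStarAlgType R)
    (m : nat) (a x y : A) : Prop :=
  [/\ a = x + y,
      star x * a ^+ m.-1 * y = 0,
      y * x = 0,
      exists z : A, right_group_inverse x z
    & quasinilpotent y].

(* Main.v *)
(* A decomposition a = x + y with a right group inverse z of x makes
   x z idempotent, and d := \sum_n z^(n+1) y^n is a generalized right Drazin
   inverse of a; the series converges because y is quasinilpotent, and only its
   equation d = z + z d y matters.  One finds a^n - a z a^n = (1 - x z) y^n.
   Conversely, if z is an m-generalized right group inverse of a, then
   z = a^n z^(n+1) for all n, so any p with |a^n - p a^n|^(1/n) -> 0 fixes every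
   a^k z.  With p = a z this gives the right group inverse z of a^2 z and the
   quasinilpotency of a - a^2 z = a (1 - a z); with p = a d it turns the
   condition on (a d)^* into the one on (a^2 z)^*. *)
Require Import Defs.
From mathcomp Require Import all_boot all_order all_algebra.
From mathcomp Require Import complex.
From mathcomp Require Import all_classical all_reals all_analysis.
From mathcomp Require Import ring.

Set Implicit Arguments.
Unset Strict Implicit.
Unset Printing Implicit Defensive.

Import Order.TTheory GRing.Theory Num.Theory.
Import numFieldNormedType.Exports.

Local Open Scope classical_set_scope.
Local Open Scope ring_scope.

(** * Root-norm decay, completeness and quasinilpotent elements *)

Section Rnorm.
Variables (R : realType) (A : banachAlgType R).
Implicit Types (x y z : A) (u : nat -> A).

Lemma normE_Rnorm x : `|x| = (Rnorm x)%:C%C.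
Proof. by rewrite /Rnorm RRe_real ?normr_real. Qed.

Lemma Rnorm_ge0 x : 0 <= Rnorm x.
Proof. by rewrite -lecR -normE_Rnorm; exact: normr_ge0. Qed.

Lemma Rnorm_eq0 x : Rnorm x = 0 -> x = 0.
Proof. by move=> x0; apply/normr0_eq0; rewrite normE_Rnorm x0. Qed.

Lemma ler_RnormD x y : Rnorm (x + y) <= Rnorm x + Rnorm y.
Proof. by rewrite -lecR rmorphD /= -!normE_Rnorm ler_normD. Qed.

Lemma RnormB x y : Rnorm (x - y) = Rnorm (y - x).
Proof. by rewrite /Rnorm distrC. Qed.

Lemma ler_RnormM x y : Rnorm (x * y) <= Rnorm x * Rnorm y.
Proof. by rewrite -lecR rmorphM /= -!normE_Rnorm bnormM. Qed.

Lemma ler_RnormMX x y n : Rnorm (x * y ^+ n) <= Rnorm x * Rnorm y ^+ n.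
Proof.
elim: n => [|n IHn]; first by rewrite !expr0 !mulr1.
rewrite !exprSr !mulrA (le_trans (ler_RnormM _ _))//.
by rewrite ler_wpM2r ?Rnorm_ge0.
Qed.

Lemma ler_nat_exp2 n : n%:R <= 2 ^+ n :> R.
Proof. by rewrite -natrX ler_nat; apply/ltnW/ltn_expl. Qed.

(** Trades [n]-th roots for geometric bounds of arbitrarily small ratio, the form in which all later
    decay arguments run. *)
Lemma root_norm_cvg0P u :
  root_norm_cvg0 u <->
  forall e : R, 0 < e -> exists C : R, forall n, Rnorm (u n) <= C * e ^+ n.
Proof.
split=> [u0 e e0|uC].
  have /cvgrPdist_lt /(_ e e0)[N _ uN] := u0.
  have term_ge0 i : 0 <= Rnorm (u i) / e ^+ i.
    by rewrite divr_ge0 ?Rnorm_ge0 ?exprn_ge0 ?ltW.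
  (* The sum covers the indices up to [N], the [1] the tail; including [N] itself ensures [n > 0] on
     the tail, so that [n%:R] is invertible. *)
  exists (1 + \sum_(i < N.+1) Rnorm (u i) / e ^+ i) => n.
  rewrite -ler_pdivrMr ?exprn_gt0//.
  have [nN|Nn] := ltnP n N.+1.
    rewrite (bigD1 (Ordinal nN))//= addrCA lerDl addr_ge0//.
    by rewrite sumr_ge0.
  rewrite (@le_trans _ _ 1)//; last by rewrite lerDl sumr_ge0.
  rewrite ler_pdivrMr ?exprn_gt0// mul1r.
  have n0 : n%:R != 0 :> R by rewrite pnatr_eq0 -lt0n (leq_trans _ Nn).
  have := uN n (ltnW Nn); rewrite /= sub0r normrN ger0_norm ?powR_ge0// => ue.
  rewrite -(powRr1 (Rnorm_ge0 (u n))) -(mulVf n0) powRrM powR_mulrn ?powR_ge0//.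
  by rewrite lerXn2r ?nnegrE ?powR_ge0 ?ltW.
apply/cvgrPdist_le => e e0.
(* Halving the ratio absorbs the constant: [C / 2 ^+ n <= 1] once [C <= n]. *)
have e20 : 0 < e / 2 by rewrite divr_gt0.
have [C uCe] := uC _ e20.
near=> n.
have n0 : n%:R != 0 :> R.
  by rewrite pnatr_eq0 -lt0n; near: n; exact: nbhs_infty_gt.
rewrite sub0r normrN ger0_norm ?powR_ge0//.
have -> : e = (e ^+ n) `^ n%:R^-1.
  by rewrite -powR_mulrn ?ltW// -powRrM mulfV// powRr1 ?ltW.
rewrite ge0_ler_powR ?invr_ge0 ?nnegrE ?Rnorm_ge0 ?exprn_ge0 ?(ltW e0)//.
rewrite (le_trans (uCe n))//.
rewrite expr_div_n mulrCA ler_piMr ?exprn_ge0 ?(ltW e0)//.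
rewrite ler_pdivrMr ?exprn_gt0// mul1r.
rewrite (@le_trans _ _ n%:R)//; first by near: n; exact: nbhs_infty_ger.
exact: ler_nat_exp2.
Unshelve. all: end_near. Qed.

Lemma root_norm_cvg0_mul (b c : A) u :
  root_norm_cvg0 u -> root_norm_cvg0 (fun n => b * u n * c).
Proof.
move/root_norm_cvg0P => u0; apply/root_norm_cvg0P => e /u0[C uC].
exists (Rnorm b * C * Rnorm c) => n.
rewrite (le_trans (ler_RnormM _ _))// mulrAC ler_wpM2r ?Rnorm_ge0//.
by rewrite (le_trans (ler_RnormM _ _))// -mulrA ler_wpM2l ?Rnorm_ge0.
Qed.

Lemma root_norm_cvg0_unshift u :
  root_norm_cvg0 (fun n => u n.+1) -> root_norm_cvg0 u.
Proof.
move/root_norm_cvg0P => u0; apply/root_norm_cvg0P => e e0.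
have [C uC] := u0 e e0.
exists (Num.max (Rnorm (u 0)) (C / e)) => -[|n].
  by rewrite expr0 mulr1 le_max lexx.
rewrite (le_trans (uC n))// exprS mulrA ler_wpM2r ?exprn_ge0 ?(ltW e0)//.
by rewrite -ler_pdivrMr// le_max lexx orbT.
Qed.

Lemma root_norm_cvg0_ext u v :
  u =1 v -> root_norm_cvg0 u -> root_norm_cvg0 v.
Proof. by move=> /funext ->. Qed.

(** The decay of [u] beats the at most geometric growth of [x ^+ n]. *)
Lemma root_norm_cvg0_mulX_eq0 u x w :
  root_norm_cvg0 u -> (forall n, w = u n * x ^+ n) -> w = 0.
Proof.
move=> /root_norm_cvg0P u0 wE; apply: Rnorm_eq0; apply/eqP.
rewrite eq_le Rnorm_ge0 andbT.
(* The [+ 1] keeps [M] positive when [x = 0]; the ratio [(2 * M)^-1] then leaves a factor 1/2 for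
   each power of [x]. *)
pose M := Rnorm x + 1.
have M0 : 0 < M by rewrite ltr_wpDl ?Rnorm_ge0.
have e0 : 0 < (2 * M)^-1 by rewrite invr_gt0 mulr_gt0.
have [C uC] := u0 _ e0.
have C0 : 0 <= C.
  by have := uC 0; rewrite expr0 mulr1; apply: le_trans (Rnorm_ge0 _).
apply/ler_addgt0Pr => e ep; rewrite add0r.
pose n := Num.bound (C / e).
have w_le : Rnorm w <= C / 2 ^+ n.
  rewrite (wE n) (le_trans (ler_RnormMX _ _ _))//.
  rewrite (@le_trans _ _ (C * (2 * M)^-1 ^+ n * M ^+ n))//.
    rewrite ler_pM ?Rnorm_ge0 ?exprn_ge0 ?Rnorm_ge0//.
    rewrite lerXn2r ?nnegrE ?Rnorm_ge0//.
      exact: ltW.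
    by rewrite lerDl.
  by rewrite -mulrA -exprMn invfM -mulrA mulVf ?gt_eqF// mulr1 exprVn.
rewrite (le_trans w_le)// ler_pdivrMr ?exprn_gt0// mulrC -ler_pdivrMr//.
rewrite (@le_trans _ _ n%:R)//.
  by apply/ltW/archi_boundP; rewrite divr_ge0// ltW.
exact: ler_nat_exp2.
Qed.

Lemma cvg_geometric_increments (s : nat -> A) (C : R) :
    (forall n, Rnorm (s n.+1 - s n) <= C / 2 ^+ n) ->
  exists l : A, forall e : R, 0 < e -> \forall n \near \oo, Rnorm (s n - l) < e.
Proof.
move=> sC.
have C0 : 0 <= C.
  by have := sC 0; rewrite expr0 divr1; apply: le_trans (Rnorm_ge0 _).
(* The right-hand side is the exact sum of [C / 2 ^+ i] for [N <= i < N + k], so the induction step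
   closes with an equality. *)
have tail N k :
    Rnorm (s (N + k)%N - s N) <= (2 * C) / 2 ^+ N - (2 * C) / 2 ^+ (N + k).
  elim: k => [|k IHk]; first by rewrite addn0 !subrr /Rnorm normr0.
  rewrite -[s _](subrK (s (N + k)%N)) -addrA.
  rewrite (le_trans (ler_RnormD _ _))// addnS.
  rewrite (le_trans (lerD (sC _) IHk))// exprS invfM.
  by rewrite le_eqVlt; apply/orP; left; apply/eqP; field; rewrite ?expf_neq0.
have /cauchy_cvgP/cvg_ex[l sl] : cauchy (s @ \oo).
  apply/cauchy_exP => e e0.
  have eE : e = (complex.Re e)%:C%C by rewrite RRe_real// gtr0_real.
  have re0 : 0 < complex.Re e by rewrite -ltcR -eE.
  pose N := Num.bound (2 * C / complex.Re e).
  exists (s N), N => // n /= Nn.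
  rewrite -ball_normE /= eE normE_Rnorm ltcR RnormB -(subnKC Nn).
  rewrite (le_lt_trans (tail _ _))// ltrBlDr.
  rewrite (@lt_le_trans _ _ (complex.Re e))//; last first.
    by rewrite lerDl divr_ge0 ?mulr_ge0 ?exprn_ge0.
  rewrite ltr_pdivrMr ?exprn_gt0// [_ * 2 ^+ N]mulrC -ltr_pdivrMr//.
  apply: lt_le_trans (ler_nat_exp2 N).
  by apply: archi_boundP; rewrite divr_ge0 ?mulr_ge0// ltW.
exists l => e e0; have /cvgrPdist_lt /(_ e%:C%C) := sl.
rewrite ltcR => /(_ e0); apply: filterS => n.
by rewrite normE_Rnorm ltcR RnormB.
Qed.

(* The iterates of [u |-> z + z * u * y] are the partial sums of the series
   with terms [z ^+ n.+1 * y ^+ n]. *)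
Lemma sandwich_fixpoint (z y : A) :
  quasinilpotent y -> exists d, d = z + z * d * y.
Proof.
move=> /root_norm_cvg0P yC.
pose s := fix s n : A := if n is k.+1 then z + z * s k * y else 0.
have incr n : s n.+1 - s n = z ^+ n.+1 * y ^+ n.
  elim: n => [|n IHn]; first by rewrite /= mulr0 mul0r addr0 subr0 mulr1.
  rewrite [s n.+2]/= [in X in _ - X]/= opprD addrACA subrr add0r.
  rewrite -mulrBl -mulrBr.
  by rewrite -/(s n.+1) IHn [z ^+ n.+2]exprS [y ^+ n.+1]exprSr !mulrA.
pose M := Rnorm z + 1.
have M0 : 0 < M by rewrite ltr_wpDl ?Rnorm_ge0.
have e0 : 0 < (2 * M)^-1 by rewrite invr_gt0 mulr_gt0.
have [C uC] := yC _ e0.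
have [|d sd] := @cvg_geometric_increments s (Rnorm z * C).
  move=> n; rewrite incr (le_trans (ler_RnormM _ _))//.
  have zM : Rnorm (z ^+ n.+1) <= Rnorm z * M ^+ n.
    rewrite exprS (le_trans (ler_RnormMX _ _ _))// ler_wpM2l ?Rnorm_ge0//.
    by rewrite lerXn2r ?nnegrE ?Rnorm_ge0 ?(ltW M0)// lerDl.
  rewrite (le_trans (ler_pM _ _ zM (uC n))) ?Rnorm_ge0//.
  by rewrite mulrACA -exprMn invfM mulrCA mulfV ?gt_eqF// mulr1 exprVn.
exists d; apply/eqP; rewrite -subr_eq0; apply/eqP/Rnorm_eq0/eqP.
rewrite eq_le Rnorm_ge0 andbT; apply/ler_addgt0Pr => e ep; rewrite add0r.
(* [K] is chosen so that the two errors of size [e / K], one of them multiplied by [z] and [y], add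
   up to [e]. *)
pose K := 1 + Rnorm z * Rnorm y.
have K0 : 0 < K by rewrite ltr_pwDl ?mulr_ge0 ?Rnorm_ge0.
have [N _ sN] := sd _ (divr_gt0 ep K0).
have -> : d - (z + z * d * y) = (d - s N.+1) + z * (s N - d) * y.
  by rewrite mulrBr mulrBl /= !opprD !addrA subrK.
rewrite (le_trans (ler_RnormD _ _))// RnormB.
have /ltW := sN N.+1 (leqnSn N); have /ltW := sN N (leqnn N).
rewrite RnormB => sN0 sN1.
have -> : e = e / K + Rnorm z * (e / K) * Rnorm y.
  by rewrite /K; field; rewrite -/K gt_eqF.
rewrite lerD// (le_trans (ler_RnormM _ _))// ler_wpM2r ?Rnorm_ge0//.
by rewrite (le_trans (ler_RnormM _ _))// ler_wpM2l ?Rnorm_ge0// RnormB.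
Qed.

(** The powers of [q * a] collapse to [q * a ^+ n] for [n > 0]; only index 0 differs, hence the
    shifts. *)
Lemma quasinilpotent_corner (q a : A) :
    q * a * q = q * a ->
  quasinilpotent (q * a) <-> root_norm_cvg0 (fun n => q * a ^+ n).
Proof.
move=> qaq.
have qaX n : (q * a) ^+ n.+1 = q * a ^+ n.+1.
  elim: n => [|n IHn]; first by rewrite !expr1.
  by rewrite exprS IHn mulrA qaq -mulrA -exprS.
split=> qa0; apply: root_norm_cvg0_unshift.
  apply: root_norm_cvg0_ext (root_norm_cvg0_mul 1 (q * a) qa0) => n.
  by rewrite mul1r -exprSr qaX.
apply: root_norm_cvg0_ext (root_norm_cvg0_mul 1 a qa0) => n.
by rewrite qaX mul1r -mulrA -exprSr.
Qed.

(** This rests on [(y * x) ^+ n.+1 = y * (x * y) ^+ n * x]. *)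
Lemma quasinilpotentMC (x y : A) :
  quasinilpotent (x * y) -> quasinilpotent (y * x).
Proof.
move=> xy0; apply: root_norm_cvg0_unshift.
apply: root_norm_cvg0_ext (root_norm_cvg0_mul y x xy0).
elim=> [|n IHn]; first by rewrite expr0 mulr1 expr1.
by rewrite [RHS]exprSr -IHn exprSr !mulrA.
Qed.

End Rnorm.


(** * Algebra of the inverses and of the decomposition *)

Section Decomposition.
Variables (R : realType) (A : banachAlgType R).
Implicit Types a d p x y z : A.

(** Since [a ^+ k * x = a ^+ n * (a ^+ k * x) * x ^+ n], the defect equals [(a ^+ n - p * a ^+ n) *
    (a ^+ k * x) * x ^+ n] for every [n], hence vanishes. *)
Lemma fixed_orbit p a x k :
    x = a * x ^+ 2 -> root_norm_cvg0 (fun n => a ^+ n - p * a ^+ n) ->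
  p * (a ^+ k * x) = a ^+ k * x.
Proof.
move=> axx pa0.
have xE n : x = a ^+ n * x ^+ n.+1.
  elim: n => [|n IHn]; first by rewrite mul1r expr1.
  transitivity (a ^+ n * (a * x ^+ 2) * x ^+ n); last first.
    by rewrite mulrA -exprSr -mulrA -exprD.
  by rewrite -axx -mulrA -exprS.
apply/eqP; rewrite -subr_eq0 -oppr_eq0 opprB; apply/eqP.
apply: root_norm_cvg0_mulX_eq0 (root_norm_cvg0_mul 1 (a ^+ k * x) pa0) _ => n.
have {1 2}-> : a ^+ k * x = a ^+ n * (a ^+ k * x) * x ^+ n.
  by rewrite mulrA -exprD addnC exprD -!mulrA -exprS -xE.
by rewrite mul1r !mulrBl !mulrA.
Qed.

Lemma right_group_inverse_sqr_mul a x :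
    x = a * x ^+ 2 -> a * x * (a * x) = a * x ->
    a * x * (a ^+ 2 * x) = a ^+ 2 * x ->
  right_group_inverse (a ^+ 2 * x) x.
Proof.
move=> axx axK axa2x.
have a2xx : a ^+ 2 * x * x = a * x.
  by rewrite expr2 -!mulrA -expr2 -axx.
split; last by rewrite a2xx.
- by rewrite [x ^+ 2 in LHS]expr2 mulrA a2xx -mulrA -expr2.
- rewrite a2xx axa2x [(_ * x) ^+ 2]expr2 -mulrA a2xx.
  by rewrite [a ^+ 2]expr2 -[a * a * x]mulrA -mulrA axK.
Qed.

Lemma gen_right_Drazin_fixed a d :
    gen_right_Drazin_inverse a d ->
  root_norm_cvg0 (fun n => a ^+ n - a * d * a ^+ n).
Proof.
case=> add a2d a0; pose q := 1 - a * d.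
have qE n : a ^+ n - a * d * a ^+ n = q * a ^+ n by rewrite mulrBl mul1r.
have adK : a * d * (a * d) = a * d.
  by rewrite mulrA -a2d expr2 -mulrA -mulrA -expr2 add.
(* Here [q * a * (a * d) = q * (a * d) * a], and [q] kills the idempotent [a * d]. *)
have qaq : q * a * q = q * a.
  rewrite mulrBr mulr1 -[RHS]subr0; congr (_ - _).
  by rewrite mulrA -[q * a * a]mulrA -expr2 -mulrA a2d mulrBl mul1r !mulrA
             -[_ * d * a * d]mulrA adK subrr.
apply: root_norm_cvg0_ext (proj1 (quasinilpotent_corner qaq) _) => [n|].
  by rewrite qE.
by rewrite mulrBl mul1r.
Qed.

Section DecompositionInverse.
Variables a x y z d : A.
Hypotheses (axy : a = x + y) (yx : y * x = 0) (xz : right_group_inverse x z).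

Let xz2 : x * z ^+ 2 = z. Proof. by case: xz. Qed.
Let xzx : x * z * x = x. Proof. by case: xz. Qed.
Let x2z : x ^+ 2 * z = x. Proof. by case: xz => _ -> _. Qed.

Let yz : y * z = 0.
Proof. by rewrite -xz2 mulrA yx mul0r. Qed.

Lemma mul_right_group_inverse : a * z = x * z.
Proof. by rewrite axy mulrDl yz addr0. Qed.

Lemma sqr_mul_right_group_inverse : a ^+ 2 * z = x.
Proof.
rewrite expr2 -mulrA mul_right_group_inverse axy mulrDl mulrA -expr2 x2z.
by rewrite mulrA yx mul0r addr0.
Qed.

Lemma right_group_inverse_fixed n :
  a ^+ n - a * z * a ^+ n = (1 - x * z) * y ^+ n.
Proof.
rewrite mul_right_group_inverse -{1}[a ^+ n]mul1r -mulrBl.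
case: n => [//|n]; rewrite exprS mulrA {1}axy mulrDr.
rewrite mulrBl mul1r xzx subrr add0r.
rewrite -mulrA; congr (_ * _).
(* What remains is [y * a ^+ n = y * y ^+ n], by [y * x = 0]. *)
elim: n => [|n IHn]; first by rewrite mulr1.
by rewrite [a ^+ n.+1]exprS mulrA {1}axy mulrDr yx add0r -mulrA IHn -exprS.
Qed.

Hypothesis dE : d = z + z * d * y.

(** [x * z] fixes [z], hence both terms of the equation for [d]. *)
Let xzd : x * z * d = d.
Proof.
have xzz : x * z * z = z by rewrite -mulrA -expr2.
by rewrite dE mulrDr !mulrA xzz -!mulrA.
Qed.

Let yd : y * d = 0.
Proof. by rewrite -xzd !mulrA yx !mul0r. Qed.

Let adE : a * d = x * z + d * y.
Proof. by rewrite axy mulrDl yd addr0 {1}dE mulrDr !mulrA xzd. Qed.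

Lemma mul_sandwich_fixpoint : a * d = x * d.
Proof. by rewrite axy mulrDl yd addr0. Qed.

Lemma gen_right_Drazin_sandwich_fixpoint :
  quasinilpotent y -> gen_right_Drazin_inverse a d.
Proof.
move=> y0.
have adad : a * d * a = x + (x * z * y + d * y * y).
  by rewrite adE axy mulrDr !mulrDl xzx -[d * y * x]mulrA yx mulr0 addr0.
split.
- by rewrite expr2 mulrA adE mulrDl xzd -mulrA yd mulr0 addr0.
- rewrite adad expr2 -mulrA adE axy mulrDl !mulrDr !mulrA yx yd !mul0r !addr0.
  by rewrite -expr2 x2z -mul_sandwich_fixpoint adE mulrDl.
- have -> : a - a * d * a = (1 - a * d) * y.
    by rewrite adad adE axy mulrBl mul1r mulrDl opprD addrACA subrr add0r.
  (* This makes [(1 - a * d) * y] a corner of [y], so it inherits quasinilpotency. *)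
  have yq : y * (1 - a * d) = y.
    by rewrite adE mulrBr mulr1 mulrDr !mulrA yx yd !mul0r addr0 subr0.
  apply/quasinilpotent_corner; first by rewrite -mulrA yq.
  apply: root_norm_cvg0_ext (root_norm_cvg0_mul (1 - a * d) 1 y0) => n.
  by rewrite mulr1.
Qed.

End DecompositionInverse.

End Decomposition.

Theorem theorem3p3 (R : realType) (A : banachStarAlgType R)
    (hproper : proper_involution A) (a : A) (m : nat) (hm : (1 <= m)%N) :
  ((exists x : A, m_gen_right_group_inverse m a x) <->
   (exists x y : A, m_gen_group_decomposition m a x y))
  /\
  (forall x y : A, m_gen_group_decomposition m a x y ->
   forall z : A, right_group_inverse x z -> m_gen_right_group_inverse m a z).
Proof.
case: m hm => // k _.
have inv_of_dec x y : m_gen_group_decomposition k.+1 a x y ->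
    forall z : A, right_group_inverse x z -> m_gen_right_group_inverse k.+1 a z.
  case=> axy /= xay yx _ y0 z xz.
  have [d dE] := sandwich_fixpoint z y0.
  exists d; split.
  - exact: (gen_right_Drazin_sandwich_fixpoint axy yx xz dE).
  - rewrite expr2 mulrA (mul_right_group_inverse axy yx xz) -mulrA -expr2.
    by case: xz.
  (* Writing [a * d] as [x * d] brings out [star x]; as [a ^+ 2 * z = x], the two sides differ by
     [star d * (star x * a ^+ k * y)], which is zero. *)
  - rewrite (mul_sandwich_fixpoint axy yx xz dE) starM.
    apply/eqP; rewrite -subr_eq0 -opprB oppr_eq0; apply/eqP.
    have -> : a ^+ k.+2 = a ^+ k * a ^+ 2 by rewrite -exprD addn2.
    rewrite -!(mulrA (star d)) -!(mulrA (star x)) -(mulrA (a ^+ k)).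
    rewrite (sqr_mul_right_group_inverse axy yx xz) exprSr -!mulrBr.
    rewrite [in a - x]axy addrAC subrr add0r.
    by rewrite [star x * _]mulrA xay mulr0.
  - apply: root_norm_cvg0_ext (root_norm_cvg0_mul (1 - x * z) 1 y0) => n.
    by rewrite mulr1 (right_group_inverse_fixed axy yx xz).
split=> //; split=> [[x [d [dD axx adx ax0]]]|[x [y dec]]]; last first.
  have [_ _ _ [z xz] _] := dec.
  by exists z; exact: inv_of_dec dec z xz.
have axK : a * x * (a * x) = a * x.
  by have := fixed_orbit 1 axx ax0; rewrite expr1.
have axa2x := fixed_orbit 2 axx ax0.
have ada2x := fixed_orbit 2 axx (gen_right_Drazin_fixed dD).
have yE : a - a ^+ 2 * x = a * (1 - a * x) by rewrite mulrBr mulr1 mulrA -expr2.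
exists (a ^+ 2 * x), (a - a ^+ 2 * x); split.
- by rewrite addrC subrK.
(* As [a * d] fixes [a ^+ 2 * x], the adjoint of the latter acquires a right factor [star (a * d)],
   to which the hypothesis [adx] applies. *)
- rewrite -{1}ada2x starM -2!mulrA.
  have -> : a ^+ k.+1.-1 * (a - a ^+ 2 * x) = a ^+ k.+1 - a ^+ k.+2 * x.
    by rewrite mulrBr mulrA -exprD addn2 -exprSr.
  by rewrite mulrBr mulrA -adx mulrA subrr mulr0.
- by rewrite yE -mulrA mulrBl mul1r axa2x subrr mulr0.
- by exists x; exact: right_group_inverse_sqr_mul.
(* With [q = 1 - a * x], swapping [a * q] to [q * a] gives a corner, and [ax0] is exactly the decay
   of [q * a ^+ n]. *)
- rewrite yE; apply: quasinilpotentMC; apply/quasinilpotent_corner.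
    rewrite mulrBr mulr1 -[RHS]subr0; congr (_ - _).
    by rewrite -mulrA [a * (a * x)]mulrA -expr2 mulrBl mul1r axa2x subrr.
  by apply: root_norm_cvg0_ext ax0 => n; rewrite mulrBl mul1r.
Qed.
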